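(* Let $\alpha\in(0,1]$. There exists a sequence of positive real numbers $\mathbf{w}=(w_n)_{n\ge1}$ such that the weighted backward shift $B_{\mathbf{w}}$ on $\ell_2(\mathbb{Z}_+)$ is a bounded operator admitting a $\mathbb{T}$-eigenvector field which is $\mu$-spanning and exactly $\alpha$-H\''olderian.
   Context: $(e_n)_{n\ge0}$ is the canonical basis of $\ell_2(\mathbb{Z}_+)$; for a bounded sequence $\mathbf{w}$ of positive reals, $B_{\mathbf{w}}e_0=0$, $B_{\mathbf{w}}e_n=w_ne_{n-1}$ ($n\ge1$). $\mathbb{T}$ is the unit circle, $\mu$ normalized Lebesgue measure on it. A $\mathbb{T}$-eigenvector field for an operator $S$ on a Hilbert space $\mathcal{H}$ is a bounded map $E:\mathbb{T}\to\mathcal{H}$ with $SE(\lambda)=\lambda E(\lambda)$ for every $\lambda\in\mathbb{T}$; it is $\mu$-spanning if for every measurable $A\subset\mathbb{T}$ with $\mu(A)=1$ the vectors $E(\lambda)$, $\lambda\in A$, span a dense subspace. $E$ is $\beta$-H\''olderian if there is $C>0$ with $\|E(e^{i\theta})-E(e^{i\theta'})\|\le C|\theta-\theta'|^{\beta}$ for all $\theta,\theta'\in[0,2\pi)$; exactly $\alpha$-H\''olderian means $\alpha$-H\''olderian and not $\beta$-H\''olderian for any $\beta>\alpha$. *)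

(* Defs.v *)
From mathcomp Require Import all_boot all_order all_algebra.
From mathcomp Require Import all_classical all_reals all_analysis.
Import Order.TTheory GRing.Theory Num.Theory numFieldNormedType.Exports.
From mathcomp.real_closed Require Import complex.

Set Implicit Arguments.
Unset Strict Implicit.
Unset Printing Implicit Defensive.

Local Open Scope classical_set_scope.
Local Open Scope ring_scope.
Local Open Scope complex_scope.

Section Defs.
Variable R : realType.

Definition abs2 (z : R[i]) : R := Re z ^+ 2 + Im z ^+ 2.

Definition cseq := nat -> R[i].

Definition in_l2 (x : cseq) : Prop := cvg (series (fun n => abs2 (x n)) @ \oo).

(* the l_2 norm (meaningful for x in l_2) *)
Definition l2norm (x : cseq) : R := Num.sqrt (limn (series (fun n => abs2 (x n)))).

Definition csub (x y : cseq) : cseq := fun n => x n - y n.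

(* weighted backward shift: B_w e_0 = 0, B_w e_n = w_n e_(n-1), i.e.
   (B_w x)_n = w_(n+1) x_(n+1).  Only w_n for n >= 1 matters. *)
Definition bshift (w : nat -> R) (x : cseq) : cseq :=
  fun n => (w n.+1)%:C * x n.+1.

Definition bounded_op (T : cseq -> cseq) : Prop :=
  (forall x, in_l2 x -> in_l2 (T x)) /\
  exists M : R, forall x, in_l2 x -> l2norm (T x) <= M * l2norm x.

Definition unitT : set R[i] := [set z | abs2 z = 1].

Definition eit (t : R) : R[i] := Complex (cos t) (sin t).

Definition T_eigenvector_field (S : cseq -> cseq) (E : R[i] -> cseq) : Prop :=
  (forall l, unitT l -> in_l2 (E l)) /\
  (exists M : R, forall l, unitT l -> l2norm (E l) <= M) /\
  (forall l, unitT l -> S (E l) = (fun n => l * E l n)).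

Definition angles (A : set R[i]) : set R :=
  [set t | 0 <= t < 2 * pi /\ A (eit t)].

(* A ⊆ T is measurable with mu(A) = 1, mu = normalized Lebesgue measure on T
   (= image of Lebesgue measure on [0,2pi) divided by 2 pi) *)
Definition full_measure (A : set R[i]) : Prop :=
  A `<=` unitT /\ measurable (angles A) /\
  (lebesgue_measure (angles A) = (2 * pi)%:E)%E.

Definition dense_span (E : R[i] -> cseq) (A : set R[i]) : Prop :=
  forall x, in_l2 x -> forall eps : R, 0 < eps ->
    exists (k : nat) (c : 'I_k -> R[i]) (ls : 'I_k -> R[i]),
      (forall j, A (ls j)) /\
      l2norm (csub x (fun n => \sum_(j < k) c j * E (ls j) n)) < eps.

Definition mu_spanning (E : R[i] -> cseq) : Prop :=
  forall A, full_measure A -> dense_span E A.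

Definition holderian (E : R[i] -> cseq) (beta : R) : Prop :=
  exists C : R, 0 < C /\
    forall t t' : R, 0 <= t < 2 * pi -> 0 <= t' < 2 * pi ->
      l2norm (csub (E (eit t)) (E (eit t'))) <= C * (`|t - t'| `^ beta).

Definition exactly_holderian (E : R[i] -> cseq) (alpha : R) : Prop :=
  holderian E alpha /\ forall beta, alpha < beta -> ~ holderian E beta.

End Defs.

(* Main.v *)
(* Eigenvectors of a weighted shift are E(l) = (a_n l^n)_n with
   a_n = 1 / (w_1 ... w_n), so |E(e^{is}) - E(e^{it})|^2 is the sum of
   a_n^2 |e^{in(s-t)} - 1|^2.  Take a_n constant on dyadic blocks, the k-th block
   having squared mass q^k.  For alpha < 1 and q = 4^(-alpha) the sum is of order
   |s - t|^(2 alpha), the blocks near 1 / |s - t| dominating; the block K alone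
   gives the lower bound at |s - t| = 2^(-K).  For alpha = 1 take q = 1/8, so that
   n a_n is square summable and E is Lipschitz; the coordinate n = 1 prevents any
   exponent > 1.  Spanning: a finitely supported x is recovered, up to a tail of
   (a_n), as a discrete Fourier combination of the E at roots of unity, and these
   are limits of E at points of any set of full measure. *)
Require Import Defs.
From mathcomp Require Import all_boot all_order all_algebra.
From mathcomp Require Import all_classical all_reals all_analysis.
Import Order.TTheory GRing.Theory Num.Theory numFieldNormedType.Exports.
From mathcomp.real_closed Require Import complex.
From mathcomp Require Import ring lra zify.
Local Open Scope ring_scope.

Set Implicit Arguments.
Unset Strict Implicit.
Unset Printing Implicit Defensive.

Local Open Scope classical_set_scope.
Local Open Scope complex_scope.

Section SquaredModulus.
Variable R : realType.
Implicit Types (z u v : R[i]) (t s x : R).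

Lemma abs2_ge0 z : 0 <= abs2 z.
Proof. by rewrite addr_ge0 ?sqr_ge0. Qed.

Lemma abs2_0 : abs2 (0 : R[i]) = 0.
Proof. by rewrite /abs2 /= expr0n addr0. Qed.

Lemma abs2_1 : abs2 (1 : R[i]) = 1.
Proof. by rewrite /abs2 /= expr0n expr1n addr0. Qed.

Lemma abs2M u v : abs2 (u * v) = abs2 u * abs2 v.
Proof. case: u => a b; case: v => c d; rewrite /abs2 /=; ring. Qed.

Lemma abs2N z : abs2 (- z) = abs2 z.
Proof. by case: z => a b; rewrite /abs2 /= !sqrrN. Qed.

Lemma abs2X z n : abs2 (z ^+ n) = abs2 z ^+ n.
Proof. by elim: n => [|n IH]; rewrite ?abs2_1 // !exprS abs2M IH. Qed.

Lemma abs2_real x : abs2 (x%:C) = x ^+ 2.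
Proof. by rewrite /abs2 /= expr0n addr0. Qed.

Lemma abs2D u v : abs2 (u + v) <= 2 * (abs2 u + abs2 v).
Proof.
case: u => a b; case: v => c d; rewrite /abs2 /=.
have := sqr_ge0 (a - c); have := sqr_ge0 (b - d); nra.
Qed.

Lemma abs2D3 u v z : abs2 (u + v + z) <= 3 * (abs2 u + abs2 v + abs2 z).
Proof.
case: u => a b; case: v => c d; case: z => e f; rewrite /abs2 /=.
have := sqr_ge0 (a - c); have := sqr_ge0 (b - d); have := sqr_ge0 (a - e).
have := sqr_ge0 (b - f); have := sqr_ge0 (c - e); have := sqr_ge0 (d - f); nra.
Qed.

Lemma abs2_sum n (F : 'I_n -> R[i]) :
  abs2 (\sum_(i < n) F i) <= 2 ^+ n * \sum_(i < n) abs2 (F i).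
Proof.
elim: n F => [|n IH] F; first by rewrite !big_ord0 abs2_0 mulr0.
rewrite !big_ord_recl.
apply: le_trans (abs2D _ _) _.
rewrite exprS -mulrA ler_wpM2l ?ler0n // mulrDr lerD //.
by rewrite ler_peMl ?abs2_ge0 ?exprn_ege1 ?ler1n.
Qed.

Lemma abs2_eit t : abs2 (eit t) = 1.
Proof. exact: cos2Dsin2. Qed.

Lemma eit0 : eit (0 : R) = 1.
Proof. by rewrite /eit cos0 sin0. Qed.

Lemma eitD s t : eit (s + t) = eit s * eit t.
Proof. by rewrite /eit cosD sinD; congr Complex; ring. Qed.

Lemma eitX t n : eit t ^+ n = eit (n%:R * t).
Proof.
elim: n => [|n IH]; first by rewrite mul0r eit0.
by rewrite exprS IH -eitD -[n.+1]add1n natrD mulrDl mul1r.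
Qed.

Lemma lipschitz1_of_deriv (f df : R -> R) :
  (forall x, is_derive x 1 f (df x)) -> (forall x, `|df x| <= 1) ->
  forall s t, `|f s - f t| <= `|s - t|.
Proof.
move=> fdf df1.
suff H s t : s <= t -> `|f s - f t| <= `|s - t|.
  move=> s t; case: (leP s t) => [/H//|/ltW/H].
  by rewrite distrC (distrC t).
move=> st.
have [|c _] := @MVT_segment R f df s t st (fun x _ => fdf x).
  apply: continuous_subspaceT => x.
  apply: differentiable_continuous; apply/derivable1_diffP.
  exact: (@ex_derive _ _ _ _ _ _ _ (fdf x)).
rewrite distrC (distrC s) => ->.
by rewrite normrM ler_piMl.
Qed.

Lemma abs2_eitB_le s t : abs2 (eit s - eit t) <= 2 * (s - t) ^+ 2.
Proof.
have sq (f : R -> R) : `|f s - f t| <= `|s - t| -> (f s - f t) ^+ 2 <= (s - t) ^+ 2.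
  by rewrite -ler_sqr ?nnegrE // !real_normK ?num_real.
rewrite /abs2 /= mulr_natl mulr2n; apply: lerD; apply: sq.
  by apply: lipschitz1_of_deriv => x; rewrite normrN sin_max.
by apply: lipschitz1_of_deriv => x; exact: cos_max.
Qed.

Lemma abs2_eitB_le4 s t : abs2 (eit s - eit t) <= 4.
Proof.
rewrite /abs2 /=; have := cos2Dsin2 s; have := cos2Dsin2 t.
have := sqr_ge0 (cos s + cos t); have := sqr_ge0 (sin s + sin t); nra.
Qed.

Lemma abs2_eitB1 t : abs2 (eit t - 1) = 2 - 2 * cos t.
Proof. rewrite /abs2 /=; have := cos2Dsin2 t; nra. Qed.

Lemma eit_neq1 t : 0 < t < 2 * pi -> eit t != 1.
Proof.
move=> /andP[t0 t2]; apply/eqP => /(congr1 (fun z => abs2 (z - 1))).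
rewrite subrr abs2_0 abs2_eitB1 => h.
have s0 : 0 < sin (t / 2) by apply: sin_gt0_pi; apply/andP; split; lra.
have := cos_mulr2n (t / 2); have -> : t / 2 *+ 2 = t by field.
move=> e.
have := cos2Dsin2 (t / 2); nra.
Qed.

End SquaredModulus.

Section SquareSummable.
Variable R : realType.
Implicit Types (x y : cseq R).

Definition sqsum x n : R := \sum_(k < n) abs2 (x k).

Lemma sqsum_series x : series (fun n => abs2 (x n)) = sqsum x.
Proof. by apply/funext => n; rewrite seriesEord. Qed.

Lemma sqsum_homo x : {homo sqsum x : m n / (m <= n)%N >-> m <= n}.
Proof.
move=> m n mn; rewrite /sqsum -!(big_mkord xpredT (fun k => abs2 (x k))).
by rewrite (big_cat_nat (leq0n m) mn) //= lerDl sumr_ge0 // => i _; rewrite abs2_ge0.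
Qed.

Lemma sqsum_ge0 x n : 0 <= sqsum x n.
Proof. by rewrite sumr_ge0 // => i _; rewrite abs2_ge0. Qed.

Lemma in_l2_bounded x b : (forall n, sqsum x n <= b) -> in_l2 x.
Proof.
move=> xb; rewrite /in_l2 sqsum_series; apply: nondecreasing_is_cvgn.
  exact: sqsum_homo.
by exists b => _ [n _ <-].
Qed.

Lemma l2norm_le x b : 0 <= b -> (forall n, sqsum x n <= b ^+ 2) -> l2norm x <= b.
Proof.
move=> b0 xb; have := in_l2_bounded xb; rewrite /in_l2 /l2norm sqsum_series => cx.
rewrite -[leRHS]ger0_norm // -sqrtr_sqr ler_wsqrtr //.
by apply: limr_le => //; near=> n; exact: xb.
Unshelve. all: by end_near. Qed.

Lemma l2norm_ge0 x : 0 <= l2norm x.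
Proof. exact: sqrtr_ge0. Qed.

Lemma sqsum_le_l2norm x n : in_l2 x -> sqsum x n <= l2norm x ^+ 2.
Proof.
rewrite /in_l2 /l2norm sqsum_series => cx.
have h := nondecreasing_cvgn_le (sqsum_homo x) cx n.
by rewrite sqr_sqrtr // (le_trans _ h) ?sqsum_ge0.
Qed.

Lemma sqsum_le x y c n : (forall k, abs2 (x k) <= c * abs2 (y k)) ->
  sqsum x n <= c * sqsum y n.
Proof. by move=> h; rewrite /sqsum mulr_sumr ler_sum. Qed.

Lemma in_l2B x y : in_l2 x -> in_l2 y -> in_l2 (csub x y).
Proof.
move=> hx hy; apply: (@in_l2_bounded _ (2 * (l2norm x ^+ 2 + l2norm y ^+ 2))) => n.
apply: (@le_trans _ _ (2 * (sqsum x n + sqsum y n))).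
  rewrite /sqsum -big_split mulr_sumr ler_sum //= => k _.
  by rewrite (le_trans (abs2D _ _)) // abs2N.
by rewrite ler_wpM2l // lerD // sqsum_le_l2norm.
Qed.

Definition tail x K : cseq R := fun n => if (n < K)%N then 0 else x n.

Lemma sqsum_tail_small x e : in_l2 x -> 0 < e ->
  exists K0, forall K n, (K0 <= K)%N -> sqsum (tail x K) n <= e.
Proof.
rewrite /in_l2 sqsum_series => cx e0.
have [K0 _ hK0] := cvgr_gt _ cx (limn (sqsum x) - e) ltac:(by rewrite ltrBlDr ltrDl).
exists K0 => K n /hK0 /= hK.
apply: (@le_trans _ _ (sqsum (tail x K) (K + n))).
  by rewrite sqsum_homo ?leq_addl.
have -> : sqsum (tail x K) (K + n) = sqsum x (K + n) - sqsum x K.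
  rewrite /sqsum !big_split_ord /= [RHS]addrC addKr big1 ?add0r => [|i _].
    by apply: eq_bigr => i _; rewrite /tail ltnNge leq_addr.
  by rewrite /tail ltn_ord abs2_0.
have := nondecreasing_cvgn_le (sqsum_homo x) cx (K + n); lra.
Qed.

End SquareSummable.

Lemma full_measure_dense (R : realType) (A : set R[i]) (t d : R) :
  full_measure A -> 0 <= t < 2 * pi -> 0 < d ->
  exists t', angles A t' /\ `|t - t'| <= d.
Proof.
move=> [_ [mA muA]] /andP[t0 t2] d0; apply: contrapT => far.
have [u [tu ud u2]] : exists u, [/\ t < u, u <= t + d & u <= 2 * pi].
  by exists (Num.min (t + d) (2 * pi)); rewrite lt_min ltrDl d0 t2 !ge_min !lexx orbT.
have disj : angles A `&` `]t, u[ = set0.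
  apply/seteqP; split=> // x [Ax] /=; rewrite in_itv /= => /andP[tx xu].
  by apply: far; exists x; split=> //; rewrite ltr0_norm; lra.
have sub : angles A `|` `]t, u[ `<=` `[0, 2 * pi[.
  move=> x [[/andP[x0 x2] _]|] /=; rewrite !in_itv /=; first by rewrite x0.
  by move=> /andP[tx xu]; apply/andP; split; lra.
have mI : measurable (`]t, u[ : set R) by exact: measurable_itv.
have : (lebesgue_measure (angles A `|` `]t, u[) <= lebesgue_measure (`[0%R, (2 * pi)%R[ : set R))%E.
  by apply: (le_measure lebesgue_measure _ _ sub); rewrite inE; [exact: measurableU|exact: measurable_itv].
have -> : (lebesgue_measure (angles A `|` `]t, u[) =
    lebesgue_measure (angles A) + lebesgue_measure (`]t, u[ : set R))%E.
  exact: measureU.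
rewrite muA !lebesgue_measure_itv /= !lte_fin tu mulr_gt0 ?pi_gt0 //.
by rewrite -!EFinB -EFinD lee_fin; lra.
Qed.

Lemma sum_roots_of_unity (F : fieldType) (z : F) n :
  z ^+ n = 1 -> z != 1 -> \sum_(j < n) z ^+ j = 0.
Proof.
move=> zn z1; apply/eqP; have /eqP := subrX1 z n.
by rewrite zn subrr eq_sym mulf_eq0 subr_eq0 (negPf z1).
Qed.

Section EigenvectorField.
Variables (R : realType) (a : nat -> R) (M S : R).
Hypothesis a_gt0 : forall n, 0 < a n.
Hypothesis a_ratio : forall n, a n <= M * a n.+1.
Hypothesis a_sqsum : forall n, \sum_(k < n) a k ^+ 2 <= S.

Definition weights (n : nat) : R := a n.-1 / a n.

Definition eigenfield (l : R[i]) : cseq R := fun n => (a n)%:C * l ^+ n.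

Lemma weights_gt0 n : 0 < weights n.
Proof. by rewrite divr_gt0. Qed.

Lemma weights_le n : weights n.+1 <= M.
Proof. by rewrite ler_pdivrMr. Qed.

Lemma bshift_weights_bounded : bounded_op (bshift weights).
Proof.
have M0 : 0 <= M by rewrite (le_trans _ (weights_le 0)) ?ltW ?weights_gt0.
have H (x : cseq R) n : in_l2 x -> sqsum (bshift weights x) n <= (M * l2norm x) ^+ 2.
  move=> hx; rewrite exprMn.
  apply: le_trans (ler_wpM2l (sqr_ge0 M) (sqsum_le_l2norm n.+1 hx)).
  rewrite {2}/sqsum big_ord_recl mulrDr; apply: ler_wpDl.
    by rewrite mulr_ge0 ?sqr_ge0 ?abs2_ge0.
  rewrite mulr_sumr ler_sum // => k _.
  rewrite /bshift abs2M abs2_real ler_wpM2r ?abs2_ge0 //.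
  by rewrite ler_sqr ?nnegrE ?weights_le // ltW ?weights_gt0.
split=> [x hx|]; first by apply: in_l2_bounded => n; exact: H.
by exists M => x hx; apply: l2norm_le => [|n]; rewrite ?mulr_ge0 ?l2norm_ge0 ?H.
Qed.

Lemma sqsum_eigenfield l n : unitT l -> sqsum (eigenfield l) n <= S.
Proof.
move=> l1; apply: le_trans (a_sqsum n); apply: ler_sum => k _.
by rewrite /eigenfield abs2M abs2_real abs2X (l1 : abs2 l = 1) expr1n mulr1.
Qed.

Lemma eigenfield_in_l2 l : unitT l -> in_l2 (eigenfield l).
Proof. by move=> l1; apply: in_l2_bounded => n; exact: sqsum_eigenfield. Qed.

Lemma eigenfieldP : T_eigenvector_field (bshift weights) eigenfield.
Proof.
split; first exact: eigenfield_in_l2.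
split=> [|l _]; last first.
  apply/funext => n; rewrite /bshift /eigenfield mulrA -rmorphM /weights /=.
  by rewrite divfK ?gt_eqF // exprS mulrCA.
have S0 : 0 <= S by rewrite (le_trans _ (a_sqsum 0)) // big_ord0.
exists (Num.sqrt S) => l l1; apply: l2norm_le => [|n]; first exact: sqrtr_ge0.
by rewrite sqr_sqrtr // sqsum_eigenfield.
Qed.

Lemma sqsum_eigenfieldB s t n :
  sqsum (csub (eigenfield (eit s)) (eigenfield (eit t))) n =
  \sum_(k < n) a k ^+ 2 * abs2 (eit (k%:R * s) - eit (k%:R * t)).
Proof.
apply: eq_bigr => k _.
by rewrite /csub /eigenfield -mulrBr abs2M abs2_real !eitX.
Qed.

Lemma eigenfield_approx A alpha t rho :
  full_measure A -> 0 < alpha -> holderian eigenfield alpha ->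
  0 <= t < 2 * pi -> 0 < rho ->
  exists l, A l /\ forall n,
    sqsum (csub (eigenfield (eit t)) (eigenfield l)) n <= rho ^+ 2.
Proof.
move=> fA al0 [C [C0 hC]] ht rho0.
have d0 : 0 < (rho / C) `^ (alpha^-1) by rewrite powR_gt0 ?divr_gt0.
have [t' [[t'2 At'] tt']] := full_measure_dense fA ht d0.
exists (eit t'); split=> // n.
have l2B : in_l2 (csub (eigenfield (eit t)) (eigenfield (eit t'))).
  by apply: in_l2B; apply: eigenfield_in_l2; exact: abs2_eit.
apply: le_trans (sqsum_le_l2norm n l2B) _.
rewrite ler_sqr ?nnegrE ?l2norm_ge0 ?(ltW rho0) //.
apply: le_trans (hC _ _ ht t'2) _.
rewrite -ler_pdivlMl // mulrC.
apply: le_trans (ge0_ler_powR (ltW al0) _ _ tt') _; rewrite ?nnegrE ?(ltW d0) //.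
by rewrite -powRrM mulVf ?gt_eqF // powRr1 // ltW ?divr_gt0.
Qed.

(* The coefficients [c j] form the discrete Fourier transform of [x n / a n]
   (n < K); by orthogonality of the characters of Z/N, the combination recovers
   [x] up to index N and is dominated by [a] beyond. *)
Lemma eigenfield_roots_of_unity (x : cseq R) K e :
  0 < e -> exists N (c : 'I_N.+1 -> R[i]), forall n,
    sqsum (csub (fun m => if (m < K)%N then x m else 0)
      (fun m => \sum_(j < N.+1) c j * eigenfield (eit (j%:R * (2 * pi / N.+1%:R))) m)) n
    <= e.
Proof.
move=> e0; pose b n := x n / (a n)%:C.
pose D := 2 ^+ K * \sum_(n < K) abs2 (b n).
have D0 : 0 <= D by rewrite mulr_ge0 ?exprn_ge0 ?sumr_ge0 // => i _; rewrite abs2_ge0.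
have T1 : unitT (1 : R[i]) by exact: abs2_1.
have [K0 hK0] := sqsum_tail_small (eigenfield_in_l2 T1) (divr_gt0 e0 (ltr_wpDl D0 ltr01)).
pose N := maxn K K0; pose th : R := 2 * pi / N.+1%:R; pose om := eit th.
have omN : om ^+ N.+1 = 1.
  rewrite eitX /th mulrC divfK ?pnatr_eq0 // /eit mulr_natl cos2pi.
  by rewrite -[_ *+ 2]add0r sinD2pi sin0.
have om0 : om != 0.
  by apply/eqP => o0; move/eqP: omN; rewrite o0 expr0n eq_sym oner_eq0.
have om1 k : (0 < k <= N)%N -> om ^+ k != 1.
  move=> /andP[k0 kN]; rewrite eitX; apply: eit_neq1.
  have p0 : 0 < 2 * pi :> R by rewrite mulr_gt0 ?pi_gt0.
  rewrite /th mulrCA; apply/andP; split.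
    by rewrite mulr_gt0 // divr_gt0 ?ltr0n.
  by rewrite gtr_pMr // ltr_pdivrMr ?ltr0n // mul1r ltr_nat.
exists N, (fun j => N.+1%:R^-1 * \sum_(n < K) b n * (om ^+ j) ^- n) => n.
pose ind m (n : nat) : R[i] := N.+1%:R^-1 * \sum_(j < N.+1) (om ^+ m / om ^+ n) ^+ j.
have comb m : \sum_(j < N.+1) (N.+1%:R^-1 * \sum_(n < K) b n * (om ^+ j) ^- n)
    * eigenfield (eit (j%:R * th)) m = (a m)%:C * \sum_(n < K) b n * ind m n.
  transitivity (\sum_(j < N.+1) \sum_(n < K)
      (a m)%:C * (b n * (N.+1%:R^-1 * (om ^+ m / om ^+ n) ^+ j))).
    apply: eq_bigr => j _; rewrite /eigenfield -eitX -/om mulr_sumr mulr_suml.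
    apply: eq_bigr => n' _; rewrite exprMn exprVn -!exprM ![(_ * j)%N]mulnC.
    by ring.
  rewrite exchange_big mulr_sumr; apply: eq_bigr => n' _ /=.
  by rewrite /ind !mulr_sumr.
have indeq m k : om ^+ m / om ^+ k = 1 -> ind m k = 1.
  rewrite /ind => ->; under eq_bigr do rewrite expr1n.
  by rewrite sumr_const card_ord mulVf ?pnatr_eq0.
have indneq m k : om ^+ m / om ^+ k != 1 -> ind m k = 0.
  move=> mk; rewrite /ind sum_roots_of_unity ?mulr0 //.
  by rewrite exprMn exprVn -!exprM ![(_ * N.+1)%N]mulnC !exprM omN !expr1n invr1 mulr1.
have om_inj m k : (m < k <= N)%N -> om ^+ m != om ^+ k.
  move=> /andP[mk kN]; rewrite -(subnK (ltnW mk)) exprD -subr_eq0 -{1}[om ^+ m]mul1r -mulrBl.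
  by rewrite mulf_neq0 ?expf_neq0 // subr_eq0 eq_sym om1 // subn_gt0 mk (leq_trans (leq_subr _ _)).
have indlt m k : (m <= N)%N -> (k <= N)%N -> m != k -> ind m k = 0.
  move=> mN kN mk; apply: indneq; rewrite -subr_eq0 -(mulfV (expf_neq0 k om0)) -mulrBl.
  rewrite mulf_neq0 ?invr_eq0 ?expf_neq0 // subr_eq0.
  by move: mk; rewrite neq_ltn => /orP[mk|km]; [|rewrite eq_sym]; rewrite om_inj ?mk ?km.
have ind1 m k : abs2 (ind m k) <= 1.
  by have [/eqP/indeq->|/indneq->] := boolP (om ^+ m / om ^+ k == 1);
    rewrite ?abs2_0 ?abs2_1.
have le_e : D * sqsum (tail (eigenfield 1) N) n <= e.
  have := hK0 N n (leq_maxr _ _); rewrite ler_pdivlMr ?ltr_wpDl //.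
  by have := sqsum_ge0 (tail (eigenfield 1) N) n; nra.
apply: le_trans le_e; apply: sqsum_le => m.
rewrite /csub comb /tail.
have [mN|Nm] := ltnP m N.
  rewrite abs2_0 mulr0.
  suff -> : (a m)%:C * \sum_(n < K) b n * ind m n = if (m < K)%N then x m else 0.
    by rewrite subrr abs2_0.
  have KN (k : 'I_K) : (k <= N)%N by rewrite (leq_trans (ltnW (ltn_ord k))) ?leq_maxl.
  case: ltnP => mK.
    rewrite (bigD1 (Ordinal mK)) //= big1 => [|k km]; last first.
      by rewrite indlt ?mulr0 ?(ltnW mN) // eq_sym.
    rewrite indeq ?divff ?expf_neq0 // addr0 mulr1 mulrCA divff ?mulr1 //.
    by rewrite eq_complex /= negb_and gt_eqF.
  rewrite big1 ?mulr0 // => k _; rewrite indlt ?mulr0 ?(ltnW mN) //.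
  by rewrite neq_ltn orbC (leq_trans (ltn_ord k)).
rewrite ltnNge (leq_trans (leq_maxl _ _) Nm) /= sub0r abs2N.
rewrite /eigenfield expr1n mulr1 abs2M mulrC ler_wpM2r ?abs2_ge0 //.
apply: le_trans (abs2_sum _) _; rewrite ler_wpM2l ?exprn_ge0 // ler_sum // => k _.
by rewrite abs2M ler_piMr ?abs2_ge0.
Qed.

Lemma eigenfield_spanning alpha :
  0 < alpha -> holderian eigenfield alpha -> mu_spanning eigenfield.
Proof.
move=> al0 hE A fA x hx eps eps0.
have e0 : 0 < (eps / 4) ^+ 2 by rewrite exprn_gt0 ?divr_gt0.
have [K /(_ K _ (leqnn K)) tailx] := sqsum_tail_small hx e0.
have [N [c hc]] := eigenfield_roots_of_unity x K e0.
pose D := 2 ^+ N.+1 * \sum_(j < N.+1) abs2 (c j).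
have D0 : 0 <= D by rewrite mulr_ge0 ?exprn_ge0 ?sumr_ge0 // => i _; rewrite abs2_ge0.
pose rho := eps / 4 / (D + 1).
have rho0 : 0 < rho by rewrite !divr_gt0 ?ltr_wpDl.
pose th : R := 2 * pi / N.+1%:R.
have near_root (j : 'I_N.+1) : exists l, A l /\ forall n,
    sqsum (csub (eigenfield (eit (j%:R * th))) (eigenfield l)) n <= rho ^+ 2.
  apply: eigenfield_approx fA al0 hE _ rho0.
  have p0 : 0 < 2 * pi :> R by rewrite mulr_gt0 ?pi_gt0.
  rewrite /th mulrCA; apply/andP; split.
    by rewrite mulr_ge0 ?divr_ge0 // ltW.
  by rewrite gtr_pMr // ltr_pdivrMr ?ltr0n // mul1r ltr_nat.
have [ls hls] := choice near_root.
exists N.+1, c, ls; split=> [j|]; first by case: (hls j).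
apply: (@le_lt_trans _ _ (3 * (eps / 4))); last by lra.
apply: l2norm_le => [|n]; first by rewrite mulr_ge0 ?divr_ge0 ?ltW.
set y1 := fun m => if (m < K)%N then x m else 0.
set y2 := fun m => \sum_(j < N.+1) c j * eigenfield (eit (j%:R * th)) m.
set y3 := fun m => \sum_(j < N.+1) c j * eigenfield (ls j) m.
have h1 : sqsum (tail x K) n <= (eps / 4) ^+ 2 by [].
have h2 : sqsum (csub y1 y2) n <= (eps / 4) ^+ 2 by exact: hc.
have h3 : sqsum (csub y2 y3) n <= (eps / 4) ^+ 2.
  apply: (@le_trans _ _ (D * rho ^+ 2)).
    apply: (@le_trans _ _ (2 ^+ N.+1 * \sum_(j < N.+1) abs2 (c j) *
        sqsum (csub (eigenfield (eit (j%:R * th))) (eigenfield (ls j))) n)).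
      under [X in _ <= _ * X]eq_bigr do rewrite mulr_sumr.
      rewrite [X in _ <= _ * X]exchange_big mulr_sumr; apply: ler_sum => m _ /=.
      rewrite /csub /y2 /y3 -sumrB; apply: le_trans (abs2_sum _) _.
      by rewrite ler_wpM2l ?exprn_ge0 // ler_sum // => j _; rewrite -mulrBr abs2M.
    rewrite -mulrA ler_wpM2l ?exprn_ge0 // mulr_suml ler_sum // => j _.
    by rewrite ler_wpM2l ?abs2_ge0 //; case: (hls j).
  rewrite /rho exprMn exprVn mulrCA ler_piMr ?sqr_ge0 //.
  by rewrite ler_pdivrMr ?exprn_gt0 ?ltr_wpDl //; nra.
apply: (@le_trans _ _ (3 * (sqsum (tail x K) n + sqsum (csub y1 y2) n + sqsum (csub y2 y3) n))).
  rewrite /sqsum -!big_split mulr_sumr ler_sum // => m _ /=.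
  have -> : csub x y3 m = tail x K m + csub y1 y2 m + csub y2 y3 m.
    by rewrite /csub /tail /y1; case: ifP => _; ring.
  exact: abs2D3.
by move: h1 h2 h3; nra.
Qed.

End EigenvectorField.

Section Geometric.
Variable R : realType.
Implicit Types x : R.

Lemma geometric_sum_le x n : 0 <= x < 1 -> \sum_(k < n) x ^+ k <= (1 - x)^-1.
Proof.
move=> /andP[x0 x1]; rewrite -[leRHS]mul1r ler_pdivlMr ?subr_gt0 // mulrC.
by rewrite -opprB mulNr -subrX1 opprB gerBl exprn_ge0.
Qed.

Lemma geometric_sum_le_last x n : 1 < x -> \sum_(k < n) x ^+ k <= x ^+ n / (x - 1).
Proof.
move=> x1; rewrite ler_pdivlMr ?subr_gt0 // mulrC -subrX1.
by rewrite gerBl.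
Qed.

Lemma cos_lt1 x : 0 < x <= pi -> cos x < 1.
Proof.
move=> /andP[x0 xpi]; rewrite -cos0 ltr_cos ?in_itv //= ?lexx ?pi_ge0 //.
by rewrite xpi ltW.
Qed.

Lemma powR_half x n : (2^-1 ^+ n) `^ x = (2 `^ (- x)) ^+ n.
Proof.
elim: n => [|n IH]; first by rewrite !expr0 powR1.
by rewrite !exprS powRM ?invr_ge0 ?exprn_ge0 // IH -powR_inv1 // -powRrM mulN1r.
Qed.

Lemma powR2_gt1 x : 0 < x -> 1 < 2 `^ x.
Proof.
move=> x0; have : 1 `^ x < 2 `^ x.
  by rewrite gt0_ltr_powR ?nnegrE ?ltr1n.
by rewrite powR1.
Qed.

Lemma powR2_lt1 x : x < 0 -> 2 `^ x < 1.
Proof.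
by move=> x0; rewrite -[x]opprK powRN invf_lt1 ?powR_gt0 ?powR2_gt1 // oppr_gt0.
Qed.

Lemma exists_dyadic_scale x : 0 < x ->
  exists K, 2^-1 ^+ K <= 2 * x /\ (K = 0%N \/ x <= 2^-1 ^+ K).
Proof.
move=> x0.
have x20 : 0 < 2 * x by rewrite mulr_gt0.
have half1 : `|2^-1 : R| < 1 by rewrite ger0_norm //; lra.
have exK : exists K, 2^-1 ^+ K <= 2 * x.
  have [K _ /(_ K (leqnn K)) /= hK] := cvgr_lt _ (cvg_expr half1) _ x20.
  by exists K; exact: ltW.
case: (ex_minnP exK) => [[|K] hK minK]; first by exists 0%N; split=> //; left.
exists K.+1; split=> //; right.
have : 2 * x < 2^-1 ^+ K by rewrite ltNge; apply/negP => /minK; rewrite ltnn.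
by rewrite [X in _ <= X]exprS; lra.
Qed.

End Geometric.

Section DyadicWeights.
Variables (R : realType) (q : R).
Hypothesis q_gt0 : 0 < q.

(* Constant on dyadic blocks, so that the k-th block carries total squared
   mass q ^ k. *)
Definition dyadic (n : nat) : R := Num.sqrt (q / 2) ^+ trunc_log 2 n.+1.

Lemma dyadic_gt0 n : 0 < dyadic n.
Proof. by rewrite exprn_gt0 // sqrtr_gt0 divr_gt0. Qed.

Lemma dyadic_sqr n : dyadic n ^+ 2 = (q / 2) ^+ trunc_log 2 n.+1.
Proof. by rewrite /dyadic exprAC sqr_sqrtr // divr_ge0 ?ltW. Qed.

Lemma dyadic_ratio : exists M, forall n, dyadic n <= M * dyadic n.+1.
Proof.
set r := Num.sqrt (q / 2).
have r0 : 0 < r by rewrite sqrtr_gt0 divr_gt0.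
exists (1 + r^-1) => n; rewrite /dyadic -/r.
have lo : (trunc_log 2 n.+1 <= trunc_log 2 n.+2)%N by apply: leq_trunc_log.
have hi : (trunc_log 2 n.+2 <= (trunc_log 2 n.+1).+1)%N.
  by rewrite -trunc_log2_double //; apply: leq_trunc_log; rewrite doubleS -addnn; lia.
have := exprn_gt0 (trunc_log 2 n.+1) r0.
have [->|->] : trunc_log 2 n.+2 = trunc_log 2 n.+1 \/
               trunc_log 2 n.+2 = (trunc_log 2 n.+1).+1 by lia.
  have : 0 < r^-1 by rewrite invr_gt0.
  by nra.
move=> h; rewrite exprS mulrA mulrDl mul1r mulVf ?gt_eqF //.
by nra.
Qed.

Lemma trunc_log_block K i : (i < 2 ^ K)%N -> trunc_log 2 (2 ^ K - 1 + i).+1 = K.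
Proof.
move=> iK; apply: trunc_log_eq => //; rewrite expnS; have := expn_gt0 2 K; lia.
Qed.

Lemma dyadic_blockS K : (2 ^ K.+1 - 1 = 2 ^ K - 1 + 2 ^ K)%N.
Proof. rewrite expnS; have := expn_gt0 2 K; lia. Qed.

Lemma dyadic_blocks_sum (v : nat -> R) K :
  \sum_(n < 2 ^ K - 1) v (trunc_log 2 n.+1) = \sum_(k < K) 2 ^+ k * v k.
Proof.
elim: K => [|K IH]; first by rewrite !big_ord0.
rewrite dyadic_blockS big_split_ord big_ord_recr /= IH; congr (_ + _).
rewrite (eq_bigr (fun=> v K)) => [|i _]; last by rewrite trunc_log_block.
by rewrite sumr_const card_ord -natrX mulr_natl.
Qed.

Lemma dyadic_sum_le (v : nat -> R) n : (forall k, 0 <= v k) ->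
  \sum_(k < n) v (trunc_log 2 k.+1) <= \sum_(k < n) 2 ^+ k * v k.
Proof.
move=> v0; rewrite -dyadic_blocks_sum.
have /subnKC <- : (n <= 2 ^ n - 1)%N by have := ltn_expl n (isT : 1 < 2)%N; lia.
by rewrite big_split_ord lerDl sumr_ge0.
Qed.

Lemma dyadic_sqsum n : q < 1 -> \sum_(k < n) dyadic k ^+ 2 <= (1 - q)^-1.
Proof.
move=> q1; under eq_bigr do rewrite dyadic_sqr.
apply: le_trans (@dyadic_sum_le (fun k => (q / 2) ^+ k) n _) _ => [k|].
  by rewrite exprn_ge0 // divr_ge0 ?ltW.
under eq_bigr do rewrite -exprMn mulrCA divff // mulr1.
by rewrite geometric_sum_le // q1 ltW.
Qed.

Lemma sqsum_dyadicB s t n :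
  sqsum (csub (eigenfield dyadic (eit s)) (eigenfield dyadic (eit t))) n <=
  \sum_(k < n) q ^+ k * Num.min 4 (8 * 4 ^+ k * (s - t) ^+ 2).
Proof.
rewrite sqsum_eigenfieldB.
pose v k : R := (q / 2) ^+ k * Num.min 4 (8 * 4 ^+ k * (s - t) ^+ 2).
have m0 k : 0 <= Num.min 4 (8 * 4 ^+ k * (s - t) ^+ 2) :> R.
  by rewrite le_min ler0n /= mulr_ge0 ?sqr_ge0 // mulr_ge0 ?exprn_ge0.
have v0 k : 0 <= v k by rewrite mulr_ge0 ?exprn_ge0 ?divr_ge0 // ltW.
apply: (@le_trans _ _ (\sum_(k < n) v (trunc_log 2 k.+1))); last first.
  apply: le_trans (dyadic_sum_le n v0) _; apply: ler_sum => k _.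
  by rewrite /v mulrA -exprMn [2 * _]mulrCA divff // mulr1.
apply: ler_sum => k _; rewrite dyadic_sqr ler_wpM2l ?exprn_ge0 ?divr_ge0 ?(ltW q_gt0) //.
rewrite le_min abs2_eitB_le4 /=.
apply: le_trans (abs2_eitB_le _ _) _; rewrite -mulrBr exprMn mulrA.
rewrite ler_wpM2r ?sqr_ge0 //.
suff : k%:R ^+ 2 <= (4 : R) ^+ (trunc_log 2 k.+1).+1 by rewrite [X in _ <= X]exprS; lra.
have kk : (k <= 2 ^ (trunc_log 2 k.+1).+1)%N.
  by have := trunc_log_ltn k.+1 (isT : 1 < 2)%N; lia.
rewrite -!natrX ler_nat (_ : 4 = 2 ^ 2)%N // -expnM mulnC expnM.
by rewrite leq_exp2r.
Qed.

Lemma sqsum_dyadic_block K :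
  (2 - 2 * cos (2^-1 : R)) * q ^+ K.+1 <=
  sqsum (csub (eigenfield dyadic (eit (2^-1 ^+ K.+1))) (eigenfield dyadic (eit 0)))
    (2 ^ K.+2 - 1).
Proof.
rewrite sqsum_eigenfieldB dyadic_blockS big_split_ord /=; apply: ler_wpDl.
  by rewrite sumr_ge0 // => i _; rewrite mulr_ge0 ?sqr_ge0 ?abs2_ge0.
apply: (@le_trans _ _ (\sum_(i < 2 ^ K.+1) (2 - 2 * cos (2^-1 : R)) * (q / 2) ^+ K.+1)).
  rewrite sumr_const card_ord -mulrnAr -[X in _ <= _ * X]mulr_natr natrX -exprMn divfK //.
apply: ler_sum => i _; rewrite dyadic_sqr trunc_log_block // mulrC.
rewrite ler_wpM2l ?exprn_ge0 ?divr_ge0 ?(ltW q_gt0) // mulr0 eit0 abs2_eitB1.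
set x := (_ + _)%:R * _.
have pK : 0 < (2 : R) ^+ K.+1 by rewrite exprn_gt0.
have x2 : x <= 2.
  rewrite /x exprVn ler_pdivrMr // -natrX -natrM ler_nat.
  by have := ltn_ord i; lia.
have x1 : 2^-1 <= x.
  rewrite /x exprVn ler_pdivlMr // ler_pdivrMl // -natrX -natrM ler_nat.
  by have := expnS 2 K; have := expn_gt0 2 K; lia.
have p2 := pi_ge2 R.
rewrite lerD2l lerN2 ler_pM2l // leNgt ltr_cos ?in_itv /= -?leNgt //; apply/andP; split; lra.
Qed.

End DyadicWeights.

Section Exactness.
Variable R : realType.
Implicit Types (a : nat -> R) (alpha beta : R).

Lemma abs2_eit_half_pow K :
  abs2 (eit 1 - 1 : R[i]) <= 4 ^+ K * abs2 (eit (2^-1 ^+ K) - 1).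
Proof.
elim: K => [|K IH]; first by rewrite !expr0 mul1r.
apply: le_trans IH _; rewrite exprSr -mulrA ler_wpM2l ?exprn_ge0 //.
have -> : eit (2^-1 ^+ K) = eit (2^-1 ^+ K.+1 : R) ^+ 2.
  by rewrite eitX exprS mulrA divff // mul1r.
rewrite subr_sqr_1 abs2M mulrC ler_wpM2r ?abs2_ge0 //.
by apply: le_trans (abs2D _ _) _; rewrite abs2_eit abs2_1; lra.
Qed.

Lemma not_holderian a alpha beta c S :
  (forall n, \sum_(k < n) a k ^+ 2 <= S) -> 0 < c ->
  (forall K, exists n, c * ((2 `^ (- alpha)) ^+ K.+1) ^+ 2 <=
    sqsum (csub (eigenfield a (eit (2^-1 ^+ K.+1))) (eigenfield a (eit 0))) n) ->
  alpha < beta -> ~ holderian (eigenfield a) beta.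
Proof.
move=> aS c0 low ab [C [C0 hC]].
pose x : R := (2 `^ (alpha - beta)) ^+ 2.
have x01 : `|x| < 1.
  rewrite ger0_norm ?sqr_ge0 // expr_lt1 ?powR_ge0 //.
  by rewrite powR2_lt1 // subr_lt0.
have e0 : 0 < c / C ^+ 2 by rewrite divr_gt0 ?exprn_gt0.
have [K _ /(_ K.+1 (leqnSn K)) /= hK] := cvgr_lt _ (cvg_expr x01) _ e0.
have [n] := low K; apply/negP; rewrite -ltNge.
have l2B : in_l2 (csub (eigenfield a (eit (2^-1 ^+ K.+1))) (eigenfield a (eit 0))).
  by apply: in_l2B; apply: (eigenfield_in_l2 aS); exact: abs2_eit.
apply: le_lt_trans (sqsum_le_l2norm n l2B) _.
have p2 := pi_ge2 R.
have half0 : 0 <= (2^-1 : R) ^+ K.+1 by rewrite exprn_ge0.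
have half1 : (2^-1 : R) ^+ K.+1 <= 1 by rewrite exprn_ile1 //; lra.
have t1 : 0 <= (2^-1 : R) ^+ K.+1 < 2 * pi by apply/andP; split; lra.
have t0 : 0 <= (0 : R) < 2 * pi by apply/andP; split; lra.
apply: (@le_lt_trans _ _ ((C * (2 `^ (- beta)) ^+ K.+1) ^+ 2)).
  rewrite ler_sqr ?nnegrE ?l2norm_ge0 ?mulr_ge0 ?exprn_ge0 ?powR_ge0 ?(ltW C0) //.
  by have := hC _ _ t1 t0; rewrite subr0 ger0_norm // powR_half.
have -> : 2 `^ (- beta) = 2 `^ (- alpha) * 2 `^ (alpha - beta) :> R.
  by rewrite -powRD ?pnatr_eq0 ?implybT // addKr.
have p0 : 0 < ((2 `^ (- alpha)) ^+ K.+1) ^+ 2 :> R by rewrite !exprn_gt0 ?powR_gt0.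
rewrite !exprMn mulrCA mulrC ltr_pM2r // exprAC -/x.
by rewrite -ltr_pdivlMl ?exprn_gt0 // mulrC.
Qed.

End Exactness.

Lemma holderian_dyadic_of_sqsum (R : realType) (q alpha C : R) :
  0 < alpha -> 0 <= C ->
  (forall x n, 0 < `|x| -> \sum_(k < n) q ^+ k * Num.min 4 (8 * 4 ^+ k * x ^+ 2)
     <= (C * `|x| `^ alpha) ^+ 2) -> 0 < q ->
  holderian (eigenfield (dyadic q)) alpha.
Proof.
move=> al0 C0 hC q0; exists (C + 1); split=> [|s t _ _]; first by rewrite ltr_wpDl.
have p0 := powR_ge0 `|s - t| alpha.
apply: (@le_trans _ _ (C * `|s - t| `^ alpha)); last by rewrite ler_wpM2r // lerDl.
apply: l2norm_le => [|n]; first exact: mulr_ge0.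
have [->|st] := eqVneq s t.
  rewrite sqsum_eigenfieldB big1 ?sqr_ge0 // => k _.
  by rewrite subrr abs2_0 mulr0.
apply: le_trans (sqsum_dyadicB q0 _ _ _) _.
by apply: hC; rewrite normr_gt0 subr_eq0.
Qed.

Lemma dyadic_field_witness (R : realType) (q alpha c : R) :
  0 < q < 1 -> 0 < alpha -> holderian (eigenfield (dyadic q)) alpha -> 0 < c ->
  (forall K, exists n, c * ((2 `^ (- alpha)) ^+ K.+1) ^+ 2 <= sqsum
    (csub (eigenfield (dyadic q) (eit (2^-1 ^+ K.+1))) (eigenfield (dyadic q) (eit 0))) n) ->
  exists w : nat -> R,
    (forall n, (1 <= n)%N -> 0 < w n) /\
    bounded_op (bshift w) /\
    exists E : R[i] -> cseq R,
      T_eigenvector_field (bshift w) E /\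
      mu_spanning E /\
      exactly_holderian E alpha.
Proof.
move=> /andP[q0 q1] al0 hE c0 low.
have [M hM] := dyadic_ratio q0.
have pos := dyadic_gt0 q0.
have S n := dyadic_sqsum q0 n q1.
exists (weights (dyadic q)); split=> [n _|]; first exact: weights_gt0.
split; first exact: (bshift_weights_bounded pos hM).
exists (eigenfield (dyadic q)); split; first exact: (eigenfieldP pos S).
split; first exact: (eigenfield_spanning pos S al0 hE).
by split=> // beta; exact: (not_holderian S c0 low).
Qed.

Lemma lipschitz_dyadic (R : realType) : holderian (eigenfield (dyadic (8^-1 : R))) 1.
Proof.
pose q : R := 8^-1; have q0 : 0 < q by rewrite invr_gt0.
apply: (@holderian_dyadic_of_sqsum _ q _ 4) => // x n x0.
rewrite powRr1 // exprMn real_normK ?num_real //.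
apply: (@le_trans _ _ (8 * x ^+ 2 * \sum_(k < n) 2^-1 ^+ k)).
  rewrite mulr_sumr; apply: ler_sum => k _.
  apply: (@le_trans _ _ (q ^+ k * (8 * 4 ^+ k * x ^+ 2))).
    by rewrite ler_wpM2l ?exprn_ge0 ?(ltW q0) // ge_min lexx orbT.
  have -> : q ^+ k * (8 * 4 ^+ k * x ^+ 2) = 8 * x ^+ 2 * (q * 4) ^+ k.
    by rewrite exprMn; ring.
  by rewrite (_ : q * 4 = 2^-1) // /q; field.
have := @geometric_sum_le R 2^-1 n ltac:(apply/andP; split; lra).
have -> : (1 - 2^-1 : R)^-1 = 2 by field.
have := sqr_ge0 x; nra.
Qed.

(* The first case of [exists_dyadic_scale] leaves nothing to the head sum; in
   the second, [4 q > 1] makes the head sum comparable to its last term, and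
   [q < 1] makes the tail comparable to its first one. *)
Lemma holderian_dyadic (R : realType) (alpha : R) :
  0 < alpha < 1 -> holderian (eigenfield (dyadic ((2 `^ (- alpha)) ^+ 2))) alpha.
Proof.
move=> /andP[al0 al1].
pose p : R := 2 `^ (- alpha); pose q := p ^+ 2.
have p0 : 0 < p by rewrite powR_gt0.
have q0 : 0 < q by rewrite exprn_gt0.
have q1 : q < 1.
  by rewrite expr_lt1 ?(ltW p0) // powR2_lt1 // oppr_lt0.
have q4 : 1 < 4 * q.
  have -> : 4 * q = (2 `^ (1 - alpha)) ^+ 2.
    by rewrite powRD ?pnatr_eq0 ?implybT // powRr1 // exprMn -natrX.
  by rewrite exprn_egt1 // powR2_gt1 // subr_gt0.
pose D := 8 / (4 * q - 1) + 4 / (1 - q).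
have D1 : 0 <= 8 / (4 * q - 1) by rewrite divr_ge0 // subr_ge0 ltW.
have D2 : 0 <= 4 / (1 - q) by rewrite divr_ge0 // subr_ge0 ltW.
apply: (@holderian_dyadic_of_sqsum _ q _ (Num.sqrt D * 2 `^ alpha)) => // x n x0.
have [K [Kx xK]] := exists_dyadic_scale x0.
apply: (@le_trans _ _ (D * q ^+ K)); last first.
  rewrite -mulrA -powRM // [X in _ <= X]exprMn sqr_sqrtr ?addr_ge0 // ler_wpM2l ?addr_ge0 //.
  rewrite /q exprAC ler_sqr ?nnegrE ?exprn_ge0 ?powR_ge0 //.
  by rewrite -powR_half ge0_ler_powR ?(ltW al0) ?nnegrE ?exprn_ge0 ?mulr_ge0.
set F := fun k : nat => q ^+ k * Num.min 4 (8 * 4 ^+ k * x ^+ 2).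
have F0 k : 0 <= F k.
  apply: mulr_ge0; first by rewrite exprn_ge0 ?(ltW q0).
  rewrite le_min ler0n /=.
  by rewrite mulr_ge0 ?sqr_ge0 // mulr_ge0 ?exprn_ge0.
apply: (@le_trans _ _ (\sum_(k < K + n) F k)).
  by rewrite addnC big_split_ord lerDl sumr_ge0.
rewrite big_split_ord /= mulrDl lerD //.
  case: xK => [->|xK]; first by rewrite big_ord0 mulr_ge0.
  apply: (@le_trans _ _ (8 * x ^+ 2 * \sum_(k < K) (4 * q) ^+ k)).
    rewrite mulr_sumr; apply: ler_sum => k _.
    apply: (@le_trans _ _ (q ^+ k * (8 * 4 ^+ k * x ^+ 2))).
      apply: ler_wpM2l; first exact/exprn_ge0/ltW.
      by rewrite ge_min lexx orbT.
    rewrite [(4 * q) ^+ k]exprMn (_ : q ^+ k * _ = 8 * x ^+ 2 * (4 ^+ k * q ^+ k)) //.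
    by ring.
  apply: (@le_trans _ _ (8 * (2^-1 ^+ K) ^+ 2 * ((4 * q) ^+ K / (4 * q - 1)))).
    apply: ler_pM.
    + by apply: mulr_ge0; rewrite ?sqr_ge0.
    + by apply: sumr_ge0 => k _; apply: exprn_ge0; lra.
    + by rewrite ler_wpM2l // -real_normK ?num_real // ler_sqr ?nnegrE ?exprn_ge0.
    + exact: geometric_sum_le_last.
  rewrite [(4 * q) ^+ K]exprMn [(2^-1 ^+ K) ^+ 2]exprAC.
  have e4 : (2^-1 ^+ 2) ^+ K * 4 ^+ K = 1 :> R.
    by rewrite -exprMn (_ : 2^-1 ^+ 2 * 4 = 1) ?expr1n //; field.
  rewrite (_ : _ * _ * _ = 8 / (4 * q - 1) * q ^+ K * ((2^-1 ^+ 2) ^+ K * 4 ^+ K)); last by ring.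
  by rewrite e4 mulr1.
apply: (@le_trans _ _ (4 * q ^+ K * \sum_(k < n) q ^+ k)).
  rewrite mulr_sumr; apply: ler_sum => k _.
  rewrite /F exprD (_ : 4 * _ * _ = q ^+ K * q ^+ k * 4); last by ring.
  apply: ler_wpM2l; last by rewrite ge_min lexx.
  by apply: mulr_ge0; exact/exprn_ge0/ltW.
rewrite [X in _ <= X]mulrAC; apply: ler_wpM2l.
  by apply: mulr_ge0 => //; exact/exprn_ge0/ltW.
by apply: geometric_sum_le; rewrite q1 ltW.
Qed.

Theorem theorem2p16 (R : realType) (alpha : R) :
  0 < alpha <= 1 ->
  exists w : nat -> R,
    (forall n, (1 <= n)%N -> 0 < w n) /\
    bounded_op (bshift w) /\
    exists E : R[i] -> cseq R,
      T_eigenvector_field (bshift w) E /\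
      mu_spanning E /\
      exactly_holderian E alpha.
Proof.
move=> /andP[al0]; rewrite le_eqVlt => /orP[/eqP al1|al1].
  pose q : R := 8^-1.
  have q0 : 0 < q by rewrite invr_gt0.
  apply: (@dyadic_field_witness _ q _ (q / 2 * abs2 (eit 1 - 1 : R[i]))) => //.
  - by rewrite q0 /q; lra.
  - by rewrite al1; exact: lipschitz_dyadic.
  - rewrite mulr_gt0 ?divr_gt0 // abs2_eitB1.
    have := @cos_lt1 R 1; have := pi_ge2 R => p2 /(_ ltac:(apply/andP; split; lra)); lra.
  - move=> K; exists 2%N; rewrite sqsum_eigenfieldB.
    rewrite big_ord_recl big_ord_recl big_ord0 addr0 /=; apply: ler_wpDl.
      by rewrite mulr_ge0 ?sqr_ge0 ?abs2_ge0.
    rewrite dyadic_sqr // mulr0 eit0 mul1r.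
    rewrite (_ : trunc_log 2 2 = 1)%N // expr1 -mulrA ler_wpM2l ?divr_ge0 ?(ltW q0) //.
    rewrite al1 powR_inv1 // exprAC -ler_pdivlMr ?exprn_gt0 //.
    apply: le_trans (abs2_eit_half_pow _ K.+1) _.
    have -> : (2^-1 ^+ 2 : R) = 4^-1 by field.
    by rewrite [4^-1 ^+ _]exprVn invrK mulrC.
pose p : R := 2 `^ (- alpha); pose q := p ^+ 2.
have p0 : 0 < p by rewrite powR_gt0.
have q0 : 0 < q by rewrite exprn_gt0.
have q1 : q < 1.
  by rewrite expr_lt1 ?(ltW p0) // powR2_lt1 // oppr_lt0.
apply: (@dyadic_field_witness _ q _ (2 - 2 * cos 2^-1)) => //.
- by rewrite q0.
- by apply: holderian_dyadic; rewrite al0.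
- have := @cos_lt1 R 2^-1; have := pi_ge2 R => p2 /(_ ltac:(apply/andP; split; lra)); lra.
- move=> K; exists (2 ^ K.+2 - 1)%N.
  by rewrite exprAC; exact: sqsum_dyadic_block.
Qed.
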